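(* Let $E\subset\mathbb N$ be such that the Gauss IFS $\Phi_E$ is regular, with conformal measure $\mu$. There is a constant $C\ge1$ such that for every $\omega\in E^{\mathbb N}$, $x=\pi(\omega)$, and $r>0$ there exists $n\ge0$ with $[\omega|_{n+1}]\subset B(x,Cr)$ and \[ M(x,n,r)\le\mu(B(x,r))\lesssim M(x,n,Cr),\qquad\text{where } M(x,n,r)=\sum_{\substack{a\in E\\ [(\omega|_n)a]\subset B(x,r)}}\mu((\omega|_n)a), \] the implied constant being independent of $\omega,r,n$.
   Context: For $a\in E$, $\phi_a(x)=1/(a+x)$; $E^*$ finite words; $\phi_\omega=\phi_{\omega_1}\circ\cdots\circ\phi_{\omega_{|\omega|}}$; $\|\phi_\omega'\|=\sup_{[0,1]}|\phi_\omega'|$; cylinder $[\omega]=\phi_\omega([0,1])$; $\omega|_n$ the length-$n$ prefix and $(\omega|_n)a$ its concatenation with the letter $a$. $\pi((a_n))=[0;a_1,a_2,\dots]$. Pressure $\mathrm P_E(s)=\lim_n\frac1n\log\sum_{\omega\in E^n}\|\phi_\omega'\|^s$; regular means $\mathrm P_E(\delta_E)=0$ for some $\delta_E$; the conformal measure is the unique Borel probability measure $\mu$ on $\pi(E^{\mathbb N})$ with $\mu(A)=\sum_{a\in E}\int_{\phi_a^{-1}(A)}|\phi_a'|^{\delta_E}d\mu$. $\mu(\omega)=\mu([\omega])$. *)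

(* Defs.v *)
From HB Require Import structures.
From mathcomp Require Import all_boot all_order all_algebra.
From mathcomp Require Import all_classical all_reals all_analysis.
Set Implicit Arguments. Unset Strict Implicit. Unset Printing Implicit Defensive.
Import Order.TTheory GRing.Theory Num.Theory numFieldNormedType.Exports.
Local Open Scope classical_set_scope.
Local Open Scope ring_scope.

Section GaussIFS.
Variable R : realType.

Definition phi (a : nat) : R -> R := fun x => (a%:R + x)^-1.

Definition phiw (w : seq nat) : R -> R := foldr (fun a f => phi a \o f) id w.

Definition dnorm (w : seq nat) : R :=
  sup [set `|derive1 (phiw w) x| | x in `[(0%R:R), (1%R:R)]%classic].

Definition cyl (w : seq nat) : set R := phiw w @` `[(0%R:R), (1%R:R)]%classic.

Definition words (E : set nat) (n : nat) : set (seq nat) :=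
  [set w | size w = n /\ (forall a, a \in w -> E a)].

Definition Zsum (E : set nat) (n : nat) (s : R) : \bar R :=
  (\esum_(w in words E n) ((dnorm w) `^ s)%:E)%E.

(* P_E(s) = lim (1/n) log Z_n(s) equals 0 (the limit, taken in the extended
   reals, exists and is 0: eventually finite, and the real sequence tends to 0) *)
Definition pressure_zero (E : set nat) (s : R) : Prop :=
  (\forall n \near \oo, (Zsum E n s < +oo)%E) /\
  ((fun n : nat => ln (fine (Zsum E n s)) / n%:R) @ \oo --> (0 : R)).

Definition regular (E : set nat) (delta : R) : Prop := pressure_zero E delta.

Definition pref (w : nat -> nat) (n : nat) : seq nat := mkseq w n.

Definition cfpi (w : nat -> nat) : R := lim ((fun n => phiw (pref w n) 0) @ \oo).

Definition limset (E : set nat) : set R :=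
  [set cfpi w | w in [set w : nat -> nat | forall n, E (w n)]].

Definition conformal (E : set nat) (delta : R) (mu : probability R R) : Prop :=
  (exists2 B : set R, measurable B /\ B `<=` limset E & mu B = 1%E) /\
  (forall A : set R, measurable A ->
     mu A = (\esum_(a in E)
               \int[mu]_(x in `[(0%R:R), (1%R:R)]%classic `&` phi a @^-1` A)
                  ((`|derive1 (phi a) x|) `^ delta)%:E)%E).

Definition Msum (E : set nat) (mu : probability R R) (w : nat -> nat) (n : nat)
  (r : R) : \bar R :=
  (\esum_(a in [set a | E a /\ cyl (rcons (pref w n) a) `<=` ball (cfpi w) r])
      mu (cyl (rcons (pref w n) a)))%E.

End GaussIFS.

Arguments cfpi {R} w.
Arguments limset {R} E.
Arguments cyl {R} w.

(* Main.v *)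
(* Take [n] least with [1/16 < q^2 r] for the continuant [q] of [w|_(n+1)], and
   write [u = w|_n], [x = phi_u(y)], [rho = q_u^2 r].  In the coordinate of
   [phi_u] the ball has radius at most [5 rho] around [y].  Inside [phi_u([0,1])]
   every letter [a] whose cylinder meets the ball has [ua] of length [O(r)], so
   that part of the ball costs no more than [M(x, n, C r)].  The ball can only
   leave the cylinder of [u] when [n > 0] and [rho] is small.
   Beyond [phi_u(0)] it lies in the cylinder of the other expansion [u'] of the
   rational [phi_u(0)]; [u] and [u'] have the same continuant, so bounded
   distortion transfers the mass of [0, 8 rho] from [u'] to [u].  Beyond
   [phi_u(1)] the next letter of [w] is [1], and with [u = va] the ball lies in
   the cylinder of [v(a+1)], whose continuant is that of [u1]. *)
Require Import Defs.
From HB Require Import structures.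
From mathcomp Require Import all_boot all_order all_algebra.
From mathcomp Require Import all_classical all_reals all_analysis.
From mathcomp Require Import ring lra measurable_realfun.
Import Order.TTheory GRing.Theory Num.Theory numFieldNormedType.Exports.
Local Open Scope classical_set_scope.
Local Open Scope ring_scope.

(** * Moebius matrices of words, continuants and distances between images *)

Section Moebius.
Context {R : realType}.
Implicit Types (u v : seq nat) (p q : R * R) (y z s t : R).

(* The Moebius matrix of the word [u] applied to homogeneous coordinates:
   [phiw u (s / t)] is the quotient of the two components of [mob u (s, t)].
   Unlike [phiw], it behaves well for [s < 0]. *)
Fixpoint mob u p : R * R :=
  if u is a :: v then ((mob v p).2, a%:R * (mob v p).2 + (mob v p).1) else p.

Definition posw u := all (leq 1) u.

(** The denominator of the rational [phiw u 0], i.e. the continuant of [u]. *)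
Definition cden u : R := (mob u (0, 1)).2.

Lemma mob_cat u v p : mob (u ++ v) p = mob u (mob v p).
Proof. by elim: u => //= a u ->. Qed.

Lemma mob_rcons u a s t : mob (rcons u a) (s, t) = mob u (t, a%:R * t + s).
Proof. by rewrite -cats1 mob_cat. Qed.

Lemma mobE u s t :
  (mob u (s, t)).1 = s * (mob u (1, 0)).1 + t * (mob u (0, 1)).1 /\
  (mob u (s, t)).2 = s * (mob u (1, 0)).2 + t * (mob u (0, 1)).2.
Proof.
elim: u => [|a u [IH1 IH2]] /=; first by split; ring.
by rewrite IH1 IH2; split; ring.
Qed.

Lemma mob_ge0 u p : 0 <= p.1 -> 0 <= p.2 ->
  0 <= (mob u p).1 /\ 0 <= (mob u p).2.
Proof.
move=> p1 p2; elim: u => //= a u [IH1 IH2]; split => //.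
by rewrite addr_ge0 // mulr_ge0.
Qed.

Lemma natr_ge1 a : (0 < a)%N -> (1 : R) <= a%:R.
Proof. by move=> a0; rewrite -[1]/(1%:R) ler_nat. Qed.

Lemma mob2_gt0 u s t : posw u -> 0 <= s -> 0 < t -> 0 < (mob u (s, t)).2.
Proof.
move=> + s0 t0; elim: u => //= a u IH /andP[a0 pu].
have [N0 _] := mob_ge0 u (s, t) s0 (ltW t0).
by rewrite ltr_wpDr // mulr_gt0 ?IH // ltr0n.
Qed.

Lemma cden_gt0 u : posw u -> 0 < cden u.
Proof. by move=> pu; exact: mob2_gt0. Qed.

Lemma phiw_mob u y : posw u -> 0 <= y ->
  phiw u y = (mob u (y, 1)).1 / (mob u (y, 1)).2.
Proof.
move=> + y0; elim: u => [_|a u IH /andP[a0 pu]] /=; first by rewrite divr1.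
rewrite IH //; have D0 := mob2_gt0 u y 1 pu y0 ltr01.
have [N0 _] := mob_ge0 u (y, 1) y0 ler01.
have E : 0 < a%:R * (mob u (y, 1)).2 + (mob u (y, 1)).1.
  by rewrite ltr_wpDr // mulr_gt0 // ltr0n.
by rewrite /phi; field; rewrite !lt0r_neq0.
Qed.

(** For nonempty [u], [(mob u (1, 0)).2] is the continuant of [u] without its last letter. Since
    [mob] recurses on the first letter, the induction also carries an inequality between the sums of
    the two components. *)
Lemma mob_inf_le u : posw u ->
  0 <= (mob u (1, 0)).2 <= cden u.
Proof.
move=> pu; have [_ ->] := mob_ge0 u (1, 0) ler01 (lexx _).
suff [] : (mob u (1, 0)).2 <= (mob u (0, 1)).2 /\
  (mob u (1, 0)).1 + (mob u (1, 0)).2 <= (mob u (0, 1)).1 + (mob u (0, 1)).2.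
  by [].
elim: u pu => [_|a u IH /andP[a0 pu]] /=; first by rewrite addr0 add0r.
have [{}IH1 IH2] := IH pu; have a1 := natr_ge1 _ a0.
suff : (a%:R - 1) * (mob u (1, 0)).2 <= (a%:R - 1) * (mob u (0, 1)).2.
  by move=> h; split; lra.
by apply: ler_wpM2l => //; rewrite subr_ge0.
Qed.

(** Fibonacci growth: two letters give [cden (a :: b :: v) >= cden (b :: v) + cden v], and
    [(3 / 2) ^+ 2 <= 3 / 2 + 1]. The factor [3 / 2] on the right makes words of length one fit. *)
Lemma cden_growth u : posw u -> (3 / 2) ^+ size u <= 3 / 2 * cden u.
Proof.
suff H : forall n u, (size u <= n)%N -> posw u ->
    (3 / 2) ^+ size u <= 3 / 2 * cden u :> R by exact: (H (size u)).
elim=> [|n IH] {u} [|a [|b v]] //= sz; rewrite ?andbT.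
- by rewrite /cden /= expr0; lra.
- by rewrite /cden /= expr0; lra.
- move=> a0; have a1 := natr_ge1 _ a0; rewrite /cden /= expr1; lra.
move=> /and3P[a0 b0 pv].
have := IH (b :: v) sz; rewrite /= b0 pv => /(_ isT) IH1.
have := IH v (ltnW sz) pv => IH2.
have a1 := natr_ge1 _ a0.
have : cden (b :: v) + cden v <= cden (a :: b :: v).
  rewrite /cden /= lerD2r -[leLHS]mul1r ler_wpM2r //.
  by apply: ltW; apply: (cden_gt0 (b :: v)); rewrite /= b0.
have : 0 <= (3 / 2) ^+ size v :> R by rewrite exprn_ge0.
by move: IH1 IH2; rewrite !exprS; lra.
Qed.

Lemma cden_cons a v : posw v -> cden (a :: v) = (a%:R + phiw v 0) * cden v.
Proof.
move=> pv; rewrite phiw_mob // /cden /=.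
by field; rewrite lt0r_neq0 // cden_gt0.
Qed.

Lemma cden_rcons_le u a : posw u -> cden (rcons u a) <= (a%:R + 1) * cden u.
Proof.
move=> pu; rewrite /cden mob_rcons mulr1 addr0 (mobE u 1 a%:R).2 mul1r.
have := mob_inf_le u pu; rewrite /cden; lra.
Qed.

(** Each letter acts by a matrix of determinant [-1]. *)
Lemma mob_det u p q :
  (mob u p).1 * (mob u q).2 - (mob u q).1 * (mob u p).2 =
  (-1) ^+ size u * (p.1 * q.2 - q.1 * p.2).
Proof.
elim: u => [|a u IH] /=; first by rewrite expr0 mul1r.
rewrite exprS -mulrA -IH; ring.
Qed.

Lemma phiw_ge0 u y : posw u -> 0 <= y -> 0 <= phiw u y.
Proof.
move=> pu y0; rewrite phiw_mob //.
by have [? ?] := mob_ge0 u (y, 1) y0 ler01; rewrite divr_ge0.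
Qed.

Lemma phiw_le1 u y : posw u -> 0 <= y <= 1 -> phiw u y <= 1.
Proof.
case: u => [|a u]; first by move=> _ /andP[].
move=> /andP[a0 pu] /andP[y0 y1] /=; rewrite /phi invf_le1.
  by rewrite (le_trans (natr_ge1 _ a0)) // lerDl phiw_ge0.
by rewrite ltr_wpDr ?phiw_ge0 // ltr0n.
Qed.

Lemma mob2_le u y : posw u -> 0 <= y -> cden u <= (mob u (y, 1)).2.
Proof.
move=> pu y0; rewrite (mobE u y 1).2 mul1r /cden lerDr mulr_ge0 //.
by have /andP[] := mob_inf_le u pu.
Qed.

Lemma phiw_sub u y z : posw u -> 0 <= y -> 0 <= z ->
  phiw u y - phiw u z =
  (-1) ^+ size u * (y - z) / ((mob u (y, 1)).2 * (mob u (z, 1)).2).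
Proof.
move=> pu y0 z0; rewrite !phiw_mob //.
have := mob_det u (y, 1) (z, 1); rewrite /= !mulr1 => <-.
by field; rewrite !lt0r_neq0 ?mob2_gt0.
Qed.

Lemma phiw_dist u y z : posw u -> 0 <= y -> 0 <= z ->
  `|phiw u y - phiw u z| <= `|y - z| / cden u ^+ 2.
Proof.
move=> pu y0 z0; rewrite phiw_sub // 2!normrM normrX normrN1 expr1n mul1r.
have Q0 := cden_gt0 u pu.
have Y0 := mob2_gt0 u y 1 pu y0 ltr01; have Z0 := mob2_gt0 u z 1 pu z0 ltr01.
rewrite normfV [X in X^-1]gtr0_norm ?mulr_gt0 // ler_wpM2l // lef_pV2 ?posrE
  ?exprn_gt0 ?mulr_gt0 //.
by rewrite expr2 ler_pM ?mob2_le // ltW.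
Qed.

(* Solving [N (s) = z D (s)] for [s] in terms of the displacement
   [kap = +- (z - x) * D (y)], where [x = N (y) / D (y)]. *)
Lemma mob_near u y z r : posw u -> 0 <= y <= 1 -> 0 < r ->
  cden u ^+ 2 * r <= 16^-1 -> `|z - phiw u y| < r ->
  exists s, [/\ `|s - y| <= 5 * (cden u ^+ 2 * r), 0 < (mob u (s, 1)).2 &
    z = (mob u (s, 1)).1 / (mob u (s, 1)).2].
Proof.
move=> pu /andP[y0 y1] r0 small zr.
have Q0 := cden_gt0 u pu.
have /andP[] := mob_inf_le u pu; set m := (mob u (1, 0)).2 => m0 mQ.
set Q := cden u in Q0 mQ small *.
set d := (mob u (y, 1)).2.
have dE : d = y * m + Q by rewrite /d (mobE u y 1).2 mul1r.
have ym0 : 0 <= y * m by rewrite mulr_ge0.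
have ymm : y * m <= m by rewrite ler_piMl.
set kap := (-1) ^+ size u * (z - phiw u y) * d.
have kapr : `|kap| <= 2 * (Q * r).
  rewrite /kap 2!normrM normrX normrN1 expr1n mul1r.
  have -> : 2 * (Q * r) = r * (2 * Q) by ring.
  by apply: ler_pM => //; [exact: ltW|rewrite gtr0_norm; lra].
have kapQ : `|kap * Q| <= 2 * (Q ^+ 2 * r).
  rewrite normrM (gtr0_norm Q0).
  have -> : 2 * (Q ^+ 2 * r) = 2 * (Q * r) * Q by ring.
  by rewrite ler_pM2r.
have kapm : `|kap * m| <= 2 * (Q ^+ 2 * r).
  by apply: le_trans kapQ; rewrite !normrM ler_wpM2l // !ger0_norm // ltW.
have km : 7 / 8 <= 1 - kap * m by move: kapm; rewrite ler_norml; lra.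
have km0 : 0 < 1 - kap * m by lra.
exists ((y + kap * Q) / (1 - kap * m)).
set s := _ / _.
have DE : (mob u (s, 1)).2 = d / (1 - kap * m).
  rewrite (mobE u s 1).2 -/m -/Q mul1r dE /s -[(mob u (0, 1)).2]/Q.
  by field; rewrite lt0r_neq0.
have d0 : 0 < d by lra.
split.
- have -> : s - y = kap * d / (1 - kap * m).
    by rewrite /s dE; field; rewrite lt0r_neq0.
  rewrite normrM normfV (gtr0_norm km0) ler_pdivrMr // normrM (gtr0_norm d0).
  have A : `|kap| * d <= 2 * (Q * r) * (2 * Q) by apply: ler_pM => //; lra.
  have E : 2 * (Q * r) * (2 * Q) = 4 * (Q ^+ 2 * r) by ring.
  (* The constant [5] is enough because [4 / (7 / 8) <= 5]; the [7 / 8] comes from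
     [|kap * m| <= 2 / 16]. *)
  have B : 5 * (Q ^+ 2 * r) * (7 / 8) <= 5 * (Q ^+ 2 * r) * (1 - kap * m).
    by rewrite ler_wpM2l // mulr_ge0 // mulr_ge0 ?sqr_ge0 // ltW.
  have C : 0 <= Q ^+ 2 * r by rewrite mulr_ge0 ?sqr_ge0 // ltW.
  by rewrite E in A; lra.
- by rewrite DE divr_gt0.
have := mob_det u (s, 1) (y, 1); rewrite /= !mulr1 -/d.
have -> : (s - y) = kap * (mob u (s, 1)).2.
  by rewrite DE dE /s; field; rewrite lt0r_neq0.
have D0 : 0 < (mob u (s, 1)).2 by rewrite DE divr_gt0.
move: (mob u (s, 1)).2 D0 {DE} => D D0 E.
have sg : (-1) ^+ size u * (-1) ^+ size u = 1 :> R.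
  by rewrite -exprD addnn -mul2n exprM sqrrN expr1n expr1n.
have : (mob u (s, 1)).1 * d - (mob u (y, 1)).1 * D = (z - phiw u y) * d * D.
  rewrite E /kap; transitivity
    ((-1) ^+ size u * (-1) ^+ size u * (z - phiw u y) * d * D); first by ring.
  by rewrite sg mul1r.
rewrite phiw_mob // -/d => F.
apply: (mulIf (lt0r_neq0 D0)); apply: (mulIf (lt0r_neq0 d0)).
rewrite divfK ?lt0r_neq0 // -[RHS](subrK ((mob u (y, 1)).1 * D)) F.
by field; rewrite lt0r_neq0.
Qed.

End Moebius.

(** * Infinite continued fractions, their digits and the limit set *)

Section ContinuedFractions.
Context {R : realType}.
Implicit Types (u v : seq nat) (w : nat -> nat) (y z s t : R).

Definition wshift n w : nat -> nat := fun k => w (n + k)%N.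

Lemma prefS w n : pref w n.+1 = w 0 :: pref (wshift 1 w) n.
Proof. by rewrite /pref /mkseq /= -[1%N]addn0 iotaDl -map_comp. Qed.

Lemma pref_rcons w n : pref w n.+1 = rcons (pref w n) (w n).
Proof. exact: mkseqS. Qed.

Lemma posw_pref w n : (forall k, (0 < w k)%N) -> posw (pref w n).
Proof. by move=> w0; apply/allP => a /mapP[k _ ->]. Qed.

Lemma phiw_cat u v y : phiw (u ++ v) y = phiw u (phiw v y).
Proof. by elim: u => //= a u ->. Qed.

Lemma phiw_rcons u a y : phiw (rcons u a) y = phiw u (phi a y).
Proof. by rewrite -cats1 phiw_cat. Qed.

(** With [phiw_dist], this makes the diameters of cylinders decay geometrically in the word
    length. *)
Lemma cden_sqr_geo u : posw u -> (cden u ^+ 2)^-1 <= 9 / 4 * (4 / 9) ^+ size u :> R.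
Proof.
move=> pu; have Q0 := @cden_gt0 R u pu.
rewrite -[leRHS]invrK lef_pV2 ?posrE ?invr_gt0 ?mulr_gt0 ?exprn_gt0 //.
have -> : (9 / 4 * (4 / 9) ^+ size u)^-1 = (2 / 3 * (3 / 2) ^+ size u) ^+ 2 :> R.
  rewrite invfM -exprVn !invf_div [RHS]exprMn exprAC.
  by congr (_ * _ ^+ _); field.
have := @cden_growth R u pu => g.
rewrite ler_sqr ?nnegrE ?mulr_ge0 ?exprn_ge0 ?(ltW Q0) //.
by lra.
Qed.

Lemma cfpi_cvg w : (forall k, (0 < w k)%N) ->
  cvg ((fun n => phiw (pref w n) (0 : R)) @ \oo).
Proof.
move=> w0; set c := fun n => _.
(* The convergents are partial sums of their increments, which [phiw_dist] and [cden_sqr_geo]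
   dominate by a geometric series. *)
have -> : c = (fun n => c 0%N + series (telescope c) n).
  by apply/funext => n; exact: eq_sum_telescope.
apply: is_cvgD; first exact: is_cvg_cst.
apply: normed_cvg.
apply: (@series_le_cvg _ _ (geometric (9 / 4) (4 / 9))) => [n|n|n|].
- exact: normr_ge0.
- by rewrite /geometric /= mulr_ge0 ?exprn_ge0.
- have pn := posw_pref w n w0.
  rewrite -[leLHS]/(`|telescope c n|) -[leRHS]/(9 / 4 * (4 / 9) ^+ n).
  have -> : telescope c n = phiw (pref w n) (phi (w n) 0) - phiw (pref w n) 0.
    by rewrite -phiw_rcons -pref_rcons.
  have h0 : 0 <= phi (w n) (0 : R) by rewrite /phi invr_ge0 addr0.
  have h1 : phi (w n) (0 : R) <= 1.
    by rewrite /phi addr0 invf_le1 ?natr_ge1 // ltr0n.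
  apply: le_trans (phiw_dist _ _ _ pn h0 (lexx _)) _.
  rewrite subr0 ger0_norm //.
  apply: le_trans (_ : (cden (pref w n) ^+ 2)^-1 <= _).
    by rewrite ler_piMl // invr_ge0 exprn_ge0 // ltW // cden_gt0.
  by have := cden_sqr_geo _ pn; rewrite size_mkseq.
- by apply: is_cvg_geometric_series; rewrite ger0_norm //; lra.
Qed.

Lemma cfpi_itv01 w : (forall k, (0 < w k)%N) -> 0 <= (cfpi w : R) <= 1.
Proof.
move=> w0; apply/andP; split.
  apply: limr_ge; first exact: cfpi_cvg.
  by near=> n; apply: phiw_ge0 => //; exact: posw_pref.
apply: limr_le; first exact: cfpi_cvg.
by near=> n; apply: phiw_le1; rewrite ?lexx ?ler01 //; exact: posw_pref.
Unshelve. all: by end_near. Qed.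

Lemma cfpi_phi w : (forall k, (0 < w k)%N) ->
  cfpi w = phi (w 0%N) (cfpi (wshift 1 w)) :> R.
Proof.
move=> w0; have w1 k : (0 < wshift 1 w k)%N by exact: w0.
have /andP[l0 _] := cfpi_itv01 _ w1.
apply: cvg_lim; first exact: norm_hausdorff.
rewrite -cvg_shiftS.
rewrite (_ : [sequence _]_n =
  (fun n => phi (w 0%N) (phiw (pref (wshift 1 w) n) 0))); last first.
  by apply/funext => n; transitivity (phiw (pref w n.+1) (0 : R)); last rewrite prefS.
apply: cvgV; first by rewrite lt0r_neq0 // ltr_wpDr // ltr0n.
apply: cvgD; first exact: cvg_cst.
exact: cfpi_cvg.
Qed.

(** By [cfpi_phi] the value is the inverse of a positive number, hence positive. The tail is then
    positive too, so the first digit plus the tail exceeds [1]. *)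
Lemma cfpi_bounds w : (forall k, (0 < w k)%N) -> 0 < (cfpi w : R) < 1.
Proof.
have pos w' : (forall k, (0 < w' k)%N) -> 0 < (cfpi w' : R).
  move=> w0; rewrite cfpi_phi // invr_gt0.
  have /andP[l0 _] := cfpi_itv01 (wshift 1 w') (fun k => w0 _).
  by rewrite ltr_wpDr // ltr0n.
move=> w0; rewrite pos //= cfpi_phi // /phi.
have l0 := pos (wshift 1 w) (fun k => w0 _).
have := @natr_ge1 R _ (w0 0%N) => a1.
by rewrite invf_lt1; lra.
Qed.

Lemma cfpi_phiw w n : (forall k, (0 < w k)%N) ->
  cfpi w = phiw (pref w n) (cfpi (wshift n w)) :> R.
Proof.
elim: n w => [//|n IH] w w0.
rewrite cfpi_phi // prefS /= (IH (wshift 1 w)) => [|k]; last exact: w0.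
by congr (phi _ (phiw _ (cfpi _))); apply/funext => k; rewrite /wshift add1n addSn.
Qed.

(** Strict bounds on [y] alone already force [|z - y| < 1], so the integers [a] and [b] cannot
    differ. *)
Lemma phi_floor (a b : nat) y z : 0 < y < 1 -> 0 <= z <= 1 ->
  phi a y = phi b z -> a = b /\ y = z.
Proof.
move=> /andP[y0 y1] /andP[z0 z1] /invr_inj E.
suff ab : a = b by split=> //; move: E; rewrite ab => /addrI.
apply/eqP; rewrite eqn_leq -(ltnS a) -(ltnS b) -!(@ltr_nat R) -!natr1.
by apply/andP; split; lra.
Qed.

(* A point of the limit set is not an endpoint of a cylinder, so the digits of
   a cylinder containing it are read off its own expansion. *)
Lemma cfpi_cyl w u s : (forall k, (0 < w k)%N) -> posw u -> 0 <= s <= 1 ->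
  cfpi w = phiw u s -> u = pref w (size u) /\ s = cfpi (wshift (size u) w).
Proof.
move=> + + s01; elim: u w => [|a u IH] w w0 pu /=; first by move=> ->.
case/andP: pu => a0 pu.
have w1 k : (0 < wshift 1 w k)%N by exact: w0.
rewrite cfpi_phi // => /phi_floor[||].
- exact: cfpi_bounds.
- by case/andP: (s01) => s0 s1; rewrite phiw_ge0 // phiw_le1.
move=> wa /(IH _ w1 pu)[uE ->]; split=> //.
by rewrite prefS wa -uE.
Qed.

(** Used also in contrapositive form: the cylinder of a positive word with a letter outside [E]
    misses the limit set. *)
Lemma limset_cyl (E : set nat) u s : (forall a, E a -> (0 < a)%N) ->
  posw u -> 0 <= s <= 1 -> limset E (phiw u s) ->
  (forall a, a \in u -> E a) /\ limset E s.
Proof.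
move=> HE pu s01 [w Ew wE].
have [uE ->] := cfpi_cyl w u s (fun k => HE _ (Ew k)) pu s01 wE; split.
  by rewrite uE => a /mapP[k _ ->]; exact: Ew.
by exists (wshift (size u) w) => // k; exact: Ew.
Qed.

Lemma limset_bounds (E : set nat) z : (forall a, E a -> (0 < a)%N) ->
  limset E z -> 0 < z < 1.
Proof. by move=> HE [w Ew <-]; apply: cfpi_bounds => k; exact: HE. Qed.

Lemma limset_phi (E : set nat) z : (forall a, E a -> (0 < a)%N) ->
  limset E z -> exists2 a, E a & exists2 y, limset E y & z = phi a y.
Proof.
move=> HE [w Ew <-]; exists (w 0%N) => //; exists (cfpi (wshift 1 w)).
  by exists (wshift 1 w) => // k; exact: Ew.
by apply: cfpi_phi => k; exact: HE.
Qed.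

End ContinuedFractions.

(** * Comparison of powers at nearby points of [[1, +oo[] *)

Section PowerComparison.
Context {R : realType}.
Implicit Types x y d p : R.

(** For [y <= x], [ln (x / y) <= x / y - 1 = (x - y) / y], and [y >= 1]. *)
Lemma ln_dist x y : 1 <= x -> 1 <= y -> `|ln x - ln y| <= `|x - y|.
Proof.
wlog yx : x y / y <= x.
  move=> H x1 y1; have [/H|/ltW /H] := leP y x; first exact.
  by rewrite distrC (distrC x); exact.
move=> x1 y1; have y0 : 0 < y by lra. have x0 : 0 < x by lra.
rewrite ger0_norm ?subr_ge0 ?ler_ln ?posrE // ger0_norm ?subr_ge0 //.
rewrite -ln_div ?posrE //.
have -> : x / y = 1 + (x - y) / y by field; rewrite lt0r_neq0.
have h : 0 <= (x - y) / y by rewrite divr_ge0 ?subr_ge0 // ltW.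
apply: (le_trans (le_ln1Dx _)); first by lra.
by rewrite ler_pdivrMr // ler_peMr // subr_ge0.
Qed.

Lemma powR_le_dist p d x y : 1 <= x -> 1 <= y -> `|x - y| <= d ->
  x `^ p <= expR (`|p| * d) * y `^ p.
Proof.
move=> x1 y1 xyd; rewrite /powR !gt_eqF; try lra.
rewrite -expRD ler_expR -lerBlDr -mulrBr.
apply: (le_trans (ler_norm _)); rewrite normrM ler_wpM2l //.
by apply: le_trans xyd; exact: ln_dist.
Qed.

End PowerComparison.

(** * The conformal measure on images of words: bounded distortion *)

Section ConformalMeasure.
Context {R : realType} (E : set nat) (delta : R) (mu : probability R R)
  (HE : forall a, E a -> (0 < a)%N) (Hmu : conformal E delta mu).
Implicit Types (u v : seq nat) (A : set R).

Local Notation p := (- (2 * delta)).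
Local Notation I01 := (`[0%R, 1%R]%classic : set R).

(** The measure is carried by a measurable [B] inside [limset E]; adding the null complement of [B]
    to [A'] makes the inclusion hold everywhere. *)
Lemma mu_le A A' : measurable A -> measurable A' ->
  A `&` limset E `<=` A' -> (mu A <= mu A')%E.
Proof.
move=> mA mA' AA'; have [[B [mB BE] B1] _] := Hmu.
have mC : measurable (~` B) by exact: measurableC.
have C0 : mu (~` B) = 0%E by rewrite probability_setC // B1 subee.
apply: (@le_trans _ _ (mu (A' `|` ~` B))).
  apply: le_measure; rewrite ?inE //; first exact: measurableU.
  by move=> x Ax; have [/BE xE|xB] := pselect (B x); [left; exact: AA'|right].
apply: le_trans (measureU2 _ mA' mC) _.
by rewrite -[leRHS]adde0 -[X in (_ <= _ + X)%E]C0.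
Qed.

Lemma mu_eq0 A : measurable A -> A `&` limset E `<=` set0 -> mu A = 0%E.
Proof.
move=> mA A0; apply/eqP; rewrite eq_le measure_ge0 andbT.
by rewrite -(measure0 mu); apply: mu_le.
Qed.

Lemma phiw_I01 u A : posw u -> A `<=` I01 -> phiw u @` A `<=` I01.
Proof.
move=> pu A01 _ [y /A01 + <-]; rewrite /= !in_itv /= => /andP[y0 y1].
by rewrite phiw_ge0 // phiw_le1 // y0.
Qed.

Lemma measurable_phi_image a A : (0 < a)%N -> measurable A -> A `<=` I01 ->
  measurable (phi a @` A).
Proof.
move=> a0 mA A01; have a1 := @natr_ge1 R _ a0.
(* The image is the preimage under the inverse map; on the positive half-line [z^-1] is written as a
   power, whose measurability is known. *)
have -> : phi a @` A =
    `]0, +oo[ `&` ((fun z => z `^ (-1) - a%:R) @^-1` A).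
  apply/seteqP; split=> [z [y Ay <-]|z []] /=; rewrite in_itv /= andbT.
    have := A01 _ Ay; rewrite /= in_itv /= => /andP[y0 _].
    have ay : 0 < a%:R + y by lra.
    rewrite /phi invr_gt0; split=> //.
    by rewrite powR_inv1 ?invrK 1?ltW ?invr_gt0 // addrC addKr.
  move=> z0; rewrite powR_inv1 ?ltW // => Az.
  by exists (z^-1 - a%:R) => //; rewrite /phi addrC subrK invrK.
apply: measurableI => //.
rewrite -[X in measurable X]setTI.
apply: (_ : measurable_fun setT (fun z : R => z `^ (-1) - a%:R)) => //.
by apply: measurable_funB => //; exact: measurable_powR.
Qed.

Lemma measurable_weight a (D : set R) : measurable D ->
  measurable_fun D (fun x : R => ((a%:R + x) `^ p)%:E).
Proof.
move=> mD; apply/measurable_EFinP; apply: measurable_funTS.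
apply: (measurableT_comp (measurable_powR p)).
by apply: measurable_funD => //.
Qed.

Lemma derive_phi a (x : R) : (0 < a)%N -> 0 <= x ->
  `|derive1 (phi a) x| `^ delta = (a%:R + x) `^ p.
Proof.
move=> a0 x0; have a1 := @natr_ge1 R _ a0.
have ax : 0 < a%:R + x by lra.
have d : is_derive x (1 : R) (phi a) (- (a%:R + x) ^- 2 *: (1 : R)).
  apply: (@is_deriveV R (fun y => a%:R + y)); first by rewrite lt0r_neq0.
  have := is_deriveD (is_derive_cst (a%:R : R) x 1) (is_derive_id x 1).
  by rewrite add0r.
rewrite derive1E (derive_val (f := phi a)) scaler1 normrN ger0_norm; last first.
  by rewrite invr_ge0 exprn_ge0 // ltW.
rewrite -powR_mulrn ?ltW // -powRN -powRrM; congr (_ `^ _); ring.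
Qed.

Lemma mu_phi a A : E a -> measurable A -> A `<=` I01 ->
  mu (phi a @` A) = (\int[mu]_(x in A) ((a%:R + x) `^ p)%:E)%E.
Proof.
move=> Ea mA A01; have [_ ->] := Hmu; last first.
  exact: measurable_phi_image (HE _ Ea) mA A01.
have F b : E b ->
    (\int[mu]_(x in I01 `&` phi b @^-1` (phi a @` A))
       ((`|derive1 (phi b) x|) `^ delta)%:E =
     \int[mu]_(x in I01 `&` (fun x : R => b%:R - a%:R + x)%R @^-1` A)
       ((b%:R + x) `^ p)%:E)%E.
  move=> Eb.
  have -> : I01 `&` phi b @^-1` (phi a @` A) =
      I01 `&` (fun x : R => b%:R - a%:R + x) @^-1` A.
    apply/seteqP; split=> x /= [x01 H]; split=> //.
      case: H => y Ay /invr_inj E1.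
      by have -> : b%:R - a%:R + x = y by lra.
    by exists (b%:R - a%:R + x) => //; rewrite /phi; congr (_^-1); lra.
  apply: eq_integral => x; rewrite inE => -[/= + _].
  by rewrite in_itv /= => /andP[x0 _]; rewrite derive_phi // HE.
rewrite (eq_esum F) (esumID [set a]); last first.
  by move=> b _; apply: integral_ge0 => x _; rewrite lee_fin powR_ge0.
have -> : E `&` [set a] = [set a] by apply/seteqP; split=> [b []//|b ->].
rewrite esum_set1; last first.
  by apply: integral_ge0 => x _; rewrite lee_fin powR_ge0.
rewrite esum1 ?adde0.
  congr (integral _ _ _); apply/seteqP; split=> x /=.
    by rewrite subrr add0r => -[].
  by rewrite subrr add0r => Ax; split => //; exact: A01.
move=> b [Eb /= ba].
have mD : measurable (I01 `&` (fun x : R => b%:R - a%:R + x) @^-1` A).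
  apply: measurableI => //; rewrite -[X in measurable X]setTI.
  apply: (_ : measurable_fun setT (fun x : R => b%:R - a%:R + x)) => //.
  exact: measurable_funD.
apply: null_set_integral => //; first exact: measurable_weight.
apply: mu_eq0 => // x [[_ /= /A01]]; rewrite /= in_itv /= => ax.
move=> /(limset_bounds _ _ HE) x01; apply: ba.
have [] := @phi_floor R b a x (b%:R - a%:R + x) x01 ax => //.
by rewrite /phi; congr (_^-1); lra.
Qed.

Let S k : R := 81 / 20 * (1 - (4 / 9) ^+ k).

(* Each letter costs a factor [exp (|p| d)] with [d] the diameter of the
   remaining cylinder; [S k] sums the bounds of [cden_sqr_geo]. *)
Lemma mu_phiw_size u A : (forall a, a \in u -> E a) ->
  measurable A -> A `<=` I01 ->
  [/\ measurable (phiw u @` A),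
    ((expR (- (`|p| * S (size u))) * cden u `^ p)%:E * mu A
       <= mu (phiw u @` A))%E &
    (mu (phiw u @` A)
       <= (expR (`|p| * S (size u)) * cden u `^ p)%:E * mu A)%E].
Proof.
move=> + mA A01; elim: u => [_|a v IH uE].
  rewrite /= image_id /S expr0 subrr !mulr0 oppr0 expR0 /cden /= powR1 !mul1r mul1e.
  by [].
have vE b : b \in v -> E b by move=> bv; apply: uE; rewrite inE bv orbT.
have Ea : E a by apply: uE; rewrite inE eqxx.
have a0 := HE _ Ea; have a1 := @natr_ge1 R _ a0.
have pv : posw v by apply/allP => b /vE /HE.
have {IH} [mv lo hi] := IH vE.
have v01 := phiw_I01 v A pv A01.
have -> : phiw (a :: v) @` A = phi a @` (phiw v @` A).
  by rewrite image_comp.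
have y00 : 0 <= phiw v (0 : R) by exact: phiw_ge0.
have Q0 := @cden_gt0 R v pv.
set d := 9 / 4 * (4 / 9) ^+ size v : R.
set c := expR (`|p| * d).
(* The weight [a + z] is compared with its value at [z = phiw v 0], because
   [cden (a :: v) = y * cden v]. *)
set y : R := a%:R + phiw v 0.
have SE : S (size v).+1 = S (size v) + d by rewrite /S /d exprS; lra.
have near z : (phiw v @` A) z -> 1 <= a%:R + z /\ `|(a%:R + z) - y| <= d.
  move=> vz; have := v01 _ vz; rewrite /= in_itv /= => /andP[z0 _].
  split; first by lra.
  case: vz => t /A01; rewrite /= in_itv /= => /andP[t0 t1] <-.
  have -> : a%:R + phiw v t - y = phiw v t - phiw v 0 by rewrite /y; ring.
  apply: le_trans (cden_sqr_geo _ pv).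
  apply: le_trans (phiw_dist _ _ _ pv t0 (lexx _)) _.
  by rewrite subr0 ger0_norm // ler_piMl // invr_ge0 exprn_ge0 // ltW.
have y1 : 1 <= y by rewrite /y; lra.
have QE : cden (a :: v) `^ p = y `^ p * cden v `^ p.
  by rewrite cden_cons // powRM // ltW //; rewrite /y; lra.
split; first exact: measurable_phi_image.
- rewrite mu_phi //.
  apply: (@le_trans _ _ (\int[mu]_(x in phiw v @` A) (c^-1 * y `^ p)%:E)%E); last first.
    apply: ge0_le_integral => //.
    + by move=> z _; rewrite lee_fin mulr_ge0 ?powR_ge0 // invr_ge0 expR_ge0.
    + exact: measurable_weight.
    + move=> z /near[z1 zy]; rewrite lee_fin ler_pdivrMl ?expR_gt0 //.
      by apply: powR_le_dist => //; rewrite distrC.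
  rewrite integral_cst //.
  apply: le_trans (lee_wpmul2l _ lo); last first.
    by rewrite lee_fin mulr_ge0 ?powR_ge0 // invr_ge0 expR_ge0.
  rewrite muleA -EFinM QE /= SE mulrDr opprD expRD -/c expRN.
  rewrite le_eqVlt; apply/orP; left; apply/eqP; congr (_%:E * _)%E.
  rewrite -/c (expRN (_ * d)) -/c; ring.
- rewrite mu_phi //.
  apply: (@le_trans _ _ (\int[mu]_(x in phiw v @` A) (c * y `^ p)%:E)%E).
    apply: ge0_le_integral => //.
    + by move=> z _; rewrite lee_fin powR_ge0.
    + exact: measurable_weight.
    + by move=> z /near[z1 zy]; rewrite lee_fin; apply: powR_le_dist.
  rewrite integral_cst //.
  apply: le_trans (lee_wpmul2l _ hi) _.
    by rewrite lee_fin mulr_ge0 ?powR_ge0 // expR_ge0.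
  rewrite muleA -EFinM QE /= SE mulrDr expRD -/c.
  rewrite le_eqVlt; apply/orP; left; apply/eqP; congr (_%:E * _)%E.
  ring.
Qed.

(** The value [81 / 20] is the sum of the whole geometric series [9 / 4 * (4 / 9) ^+ k], so the
    constant serves words of every length. *)
Definition dist_const : R := expR (`|p| * (81 / 20)).

Lemma mu_phiw u A : (forall a, a \in u -> E a) ->
  measurable A -> A `<=` I01 ->
  [/\ measurable (phiw u @` A),
    ((cden u `^ p)%:E * mu A <= dist_const%:E * mu (phiw u @` A))%E &
    (mu (phiw u @` A) <= (dist_const * cden u `^ p)%:E * mu A)%E].
Proof.
move=> uE mA A01; have [mu1 lo hi] := mu_phiw_size u A uE mA A01.
have SK : expR (`|p| * S (size u)) <= dist_const.
  rewrite ler_expR ler_wpM2l // /S.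
  have : 0 <= (4 / 9) ^+ size u :> R by rewrite exprn_ge0.
  lra.
split=> //.
- apply: (@le_trans _ _ ((expR (`|p| * S (size u)))%:E * mu (phiw u @` A))%E).
    apply: le_trans (lee_wpmul2l _ lo); last by rewrite lee_fin expR_ge0.
    by rewrite muleA -EFinM mulrA -expRD subrr expR0 mul1r.
  by apply: lee_wpmul2r => //; rewrite lee_fin.
- apply: le_trans hi _; apply: lee_wpmul2r => //.
  by rewrite lee_fin ler_wpM2r // powR_ge0.
Qed.

End ConformalMeasure.

(** * Covering and packing by cylinders, and the two sides of a cylinder *)

Section Covering.
Context {R : realType} (E : set nat) (delta : R) (mu : probability R R)
  (HE : forall a, E a -> (0 < a)%N) (Hmu : conformal E delta mu).
Implicit Types (u v : seq nat) (A : set R) (D : set nat).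

Local Notation I01 := (`[0%R, 1%R]%classic : set R).
Local Notation K := (dist_const delta).

Lemma esum_nat (D : set nat) (f : nat -> \bar R) : (forall n, (0 <= f n)%E) ->
  (\esum_(i in D) f i = \sum_(0 <= i <oo | i \in D) f i)%E.
Proof.
by move=> f0; rewrite (@nneseries_esum _ f (fun i => i \in D)) // set_mem_set.
Qed.

Lemma mu_cover D (F : nat -> set R) A : (forall a, D a -> measurable (F a)) ->
  measurable A -> A `&` limset E `<=` \bigcup_(a in D) F a ->
  (mu A <= \esum_(a in D) mu (F a))%E.
Proof.
move=> mF mA AF.
have mU : measurable (\bigcup_(a in D) F a) by exact: bigcup_measurable.
apply: le_trans (mu_le E delta mu Hmu _ _ mA mU AF) _.
rewrite esum_mkcond -nneseries_esumT; last by move=> n; case: ifP.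
under eq_eseriesr => n _.
  rewrite (_ : (if n \in D then _ else _) = mu (if n \in D then F n else set0)).
  over.
  by case: ifP; rewrite ?measure0.
apply: measure_sigma_subadditive => //; last by rewrite bigcup_mkcond.
by move=> n; case: ifP => // /set_mem; exact: mF.
Qed.

(** Neighbouring cylinders may share an endpoint, so disjointness is asked only on the limit set;
    intersecting with a carrier [B] of full measure makes the sets disjoint without loss of mass. *)
Lemma mu_disjoint D (F : nat -> set R) A : (forall a, D a -> measurable (F a)) ->
  measurable A -> (forall a, D a -> F a `<=` A) ->
  (forall a b z, D a -> D b -> limset E z -> F a z -> F b z -> a = b) ->
  (\esum_(a in D) mu (F a) <= mu A)%E.
Proof.
move=> mF mA FA dF; have [[B [mB BE] B1] _] := Hmu.
have mFB a : D a -> measurable (F a `&` B).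
  by move=> Da; apply: measurableI => //; exact: mF.
have C0 : mu (~` B) = 0%E by rewrite probability_setC // B1 subee.
have FB a : D a -> (mu (F a) <= mu (F a `&` B))%E.
  move=> Da; rewrite -[leRHS]adde0 -[X in (_ <= _ + X)%E]C0.
  have mC : measurable (~` B) by exact: measurableC.
  apply: le_trans (measureU2 _ (mFB _ Da) mC).
  apply: le_measure; rewrite ?inE; [exact: mF|by apply: measurableU => //; exact: mFB|].
  by move=> x Fx; have [xB|xB] := pselect (B x); [left|right].
apply: le_trans (le_esum FB) _.
rewrite esum_nat // -measure_bigcup //; last first.
  move=> a b Da Db [z [[Fa Bz] [Fb _]]]; exact: dF (BE _ Bz) Fa Fb.
apply: le_measure; rewrite ?inE //; first exact: bigcup_measurable.
by move=> z [a Da [Fz _]]; exact: FA Fz.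
Qed.

Lemma posw_letters u : (forall a, a \in u -> E a) -> posw u.
Proof. by move=> uE; apply/allP => a /uE /HE. Qed.

Lemma letters_rcons u a : (forall b, b \in u -> E b) -> E a ->
  forall b, b \in rcons u a -> E b.
Proof. by move=> uE Ea b; rewrite mem_rcons inE => /predU1P[->|/uE]. Qed.

Lemma measurable_cyl u : (forall a, a \in u -> E a) -> measurable (cyl u : set R).
Proof.
by move=> uE; have [] := mu_phiw E delta mu HE Hmu u I01 uE (measurable_itv _)
  (@subset_refl _ _).
Qed.

Lemma cyl_rcons u a : cyl (rcons u a) = phiw u @` (phi a @` I01).
Proof.
by rewrite image_comp; apply: eq_imagel => t _; rewrite phiw_rcons.
Qed.

Lemma mob_scale u k s t : mob u (k * s, k * t) =
  (k * (mob u (s, t)).1, k * (mob u (s, t)).2) :> R * R.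
Proof.
rewrite [LHS]surjective_pairing (mobE u (k * s) (k * t)).1 (mobE u (k * s) (k * t)).2.
by rewrite (mobE u s t).1 (mobE u s t).2; congr pair; ring.
Qed.

(* The two continued fraction expansions of the rational [phiw u 0]. *)
Lemma conj_word u : posw u -> u != [::] -> u = [:: 1%N] \/
  exists2 u', posw u' & forall s t : R, mob u' (s, t) = mob u (- s, t + s).
Proof.
case/lastP: u => // v a; rewrite /posw all_rcons => /andP[a0 pv] _.
case: a a0 => [//|[_|a _]]; last first.
  (* A last letter [a.+2] splits into [a.+1] and [1]; below, a last letter [1] is absorbed into the
     letter before it. *)
  right; exists (rcons (rcons v a.+1) 1%N) => [|s t]; first by rewrite /posw !all_rcons.
  by rewrite !mob_rcons; congr (mob v (_, _)); rewrite -!natr1; ring.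
case/lastP: v pv => [|v b]; first by left.
rewrite all_rcons => /andP[b0 pv]; right.
exists (rcons v b.+1) => [|s t]; first by rewrite /posw all_rcons.
by rewrite !mob_rcons; congr (mob v (_, _)); rewrite -?natr1; ring.
Qed.

(** * The parts of the ball beyond either endpoint of the cylinder of [u] *)

Section Sides.
(** In the application [D] is the index set of the sum at the enlarged radius, and [281] is the
    constant of [letter_size]. *)
Context (u : seq nat) (y rho : R) (D : set nat)
  (uE : forall a, a \in u -> E a) (y01 : 0 < y < 1)
  (small : u != [::] -> rho <= 16^-1) (DE : D `<=` E)
  (HD : forall a, E a ->
    (forall t, (phi a @` I01) t -> `|t - y| <= 281 * rho) -> D a).

Let pu : posw u. Proof. exact: posw_letters. Qed.
Let V := \bigcup_(a in D) (phi a @` I01).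
Let M := (\esum_(a in D) mu (cyl (rcons u a)))%E.

Let phi_I01 a : E a -> phi a @` I01 `<=` I01.
Proof.
by move=> Ea; apply: (phiw_I01 [:: a] I01) => //; rewrite /posw /= HE.
Qed.

Let mV : measurable V.
Proof.
apply: bigcup_measurable => a /DE Ea.
by apply: measurable_phi_image => //; exact: HE.
Qed.

Let V01 : V `<=` I01.
Proof. by move=> t [a /DE Ea]; exact: phi_I01. Qed.

(** The image of [V] under [phiw u] is the union of the cylinders counted by [M], so the lower
    distortion bound for [u] applies to [V]. *)
Lemma cyl_sum_ge A : measurable A -> A `&` limset E `<=` V ->
  ((cden u `^ (- (2 * delta)))%:E * mu A <= K%:E * M)%E.
Proof.
move=> mA AV; have [mu1 lo _] := mu_phiw E delta mu HE Hmu u V uE mV V01.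
apply: (@le_trans _ _ ((cden u `^ (- (2 * delta)))%:E * mu V)%E).
  apply: lee_wpmul2l; first by rewrite lee_fin powR_ge0.
  exact: mu_le Hmu _ _ mA mV AV.
apply: le_trans lo _; apply: lee_wpmul2l; first by rewrite lee_fin expR_ge0.
apply: mu_cover => // [a /DE Ea|z [[t [a Da at_] <-] _]].
  by apply: measurable_cyl; exact: letters_rcons.
by exists a => //; rewrite cyl_rcons; exists t.
Qed.

(** One distortion constant is already spent in the premise; pushing [A] forward along [v] spends
    the second. *)
Lemma mu_conj_le v A : (forall a, a \in v -> E a) -> measurable A -> A `<=` I01 ->
  ((cden v `^ (- (2 * delta)))%:E * mu A <= K%:E * M)%E ->
  (mu (phiw v @` A) <= (K * K)%:E * M)%E.
Proof.
move=> vE mA A01 H; have [_ _ hi] := mu_phiw E delta mu HE Hmu v A vE mA A01.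
apply: le_trans hi _; rewrite !EFinM -!muleA.
by apply: lee_wpmul2l => //; rewrite lee_fin expR_ge0.
Qed.

Let M0 : (0 <= (K * K)%:E * M)%E.
Proof.
apply: mule_ge0; first by rewrite lee_fin mulr_ge0 ?expR_ge0.
by apply: esum_ge0 => a _; exact: measure_ge0.
Qed.

(** [P] selects coordinates [s] beyond one endpoint of [[0, 1]]. The point is written through [mob]
    because [s] may be negative, and [5 * rho] is the radius given by [mob_near]. *)
Definition side_cover (P : set R) := exists X : set R, [/\ measurable X,
  (mu X <= (K * K)%:E * M)%E &
  forall z s, limset E z -> P s -> `|s - y| <= 5 * rho ->
    0 < (mob u (s, 1)).2 -> z = (mob u (s, 1)).1 / (mob u (s, 1)).2 -> X z].

Let side_cover0 (P : set R) :
  (forall z s, limset E z -> P s -> `|s - y| <= 5 * rho ->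
    0 < (mob u (s, 1)).2 -> z = (mob u (s, 1)).1 / (mob u (s, 1)).2 -> False) ->
  side_cover P.
Proof. by move=> H; exists set0; rewrite measure0; split=> //; exact: M0. Qed.

Lemma left_side : side_cover [set s | s < 0].
Proof.
have [y0 y1] := andP y01.
have [yr|yr] := ltP (5 * rho) y.
  by apply: side_cover0 => z s _ /= s0; rewrite ler_norml => /andP[h _] _ _; lra.
have [u0|un] := eqVneq u [::].
  apply: side_cover0 => z s /(limset_bounds _ _ HE)/andP[z0 _] /= s0 _ _.
  by rewrite u0 /= divr1 => zs; lra.
have rs := small un.
(* The exceptional word [[:: 1]] sends [s < 0] to [(1 + s)^-1 > 1], outside the limit set. *)
have [u1|[u' pu' u'E]] := conj_word u pu un.
  apply: side_cover0 => z s /(limset_bounds _ _ HE)/andP[_ z1] /= s0 _.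
  rewrite u1 /= mulr1 => D0 zE; move: z1; rewrite zE mul1r invf_lt1 //; lra.
(* [- s / (1 + s)] is the coordinate of the point with respect to [u']. As [rho <= 1 / 16], the
   denominator exceeds [11 / 16], and [5 / (11 / 16) <= 8]. *)
have tP s : s < 0 -> `|s - y| <= 5 * rho -> 0 <= - s / (1 + s) <= 8 * rho.
  move=> s0; rewrite ler_norml => /andP[h _].
  have s1 : 11 / 16 < 1 + s by lra.
  rewrite divr_ge0 ?ler_pdivrMr /=; [|lra..].
  have : 8 * rho * (11 / 16) <= 8 * rho * (1 + s) by rewrite ler_wpM2l; lra.
  lra.
have zP z s : s < 0 -> `|s - y| <= 5 * rho ->
    z = (mob u (s, 1)).1 / (mob u (s, 1)).2 -> z = phiw u' (- s / (1 + s)).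
  move=> s0 sy ->; have /andP[t0 t1] := tP s s0 sy.
  have s1 : 0 < 1 + s by move: sy; rewrite ler_norml; lra.
  rewrite phiw_mob // u'E.
  have -> : (- (- s / (1 + s)), 1 + - s / (1 + s)) =
      ((1 + s)^-1 * s, (1 + s)^-1 * 1).
    by congr pair; field; rewrite lt0r_neq0.
  by rewrite mob_scale /= -mulf_div divff ?mul1r // invr_eq0 lt0r_neq0.
have [u'L|u'L] := pselect (forall a, a \in u' -> E a); last first.
  apply: side_cover0 => z s zE s0 sy _ /(zP z s s0 sy) zz; apply: u'L.
  have /andP[t0 t1] := tP s s0 sy; rewrite zz in zE.
  have t01 : 0 <= - s / (1 + s) <= 1 by lra.
  by have [] := limset_cyl E u' _ HE pu' t01 zE.
have A01 : `[0, 8 * rho]%classic `<=` I01.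
  by move=> t /=; rewrite !in_itv /= => /andP[t0 t1]; lra.
exists (phiw u' @` `[0, 8 * rho]%classic); split.
- by have [] := mu_phiw E delta mu HE Hmu u' _ u'L (measurable_itv _) A01.
- apply: mu_conj_le => //.
  have -> : cden u' = cden u :> R.
    by rewrite /cden u'E oppr0 addr0.
  apply: cyl_sum_ge => // z [zr /(limset_phi _ _ HE)[a Ea [y' y'E zE]]].
  have /andP[y'0 y'1] := limset_bounds _ _ HE y'E.
  move: zr; rewrite /= in_itv /= => /andP[z0 zr].
  have a1 := @natr_ge1 R _ (HE _ Ea).
  exists a; last first.
    by exists y'; rewrite //= in_itv /= !ltW.
  apply: HD => // t [t' /=]; rewrite in_itv /= => /andP[t'0 t'1] <-.
  have pa0 : 0 <= phi a t' by rewrite /phi invr_ge0; lra.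
  suff : phi a t' <= 16 * rho by rewrite ler_norml; lra.
  (* The values of [phi a] on [[0, 1]] differ at most by a factor [2], since [a + 1 <= 2 * a]. *)
  apply: (@le_trans _ _ (2 * z)); last by lra.
  rewrite zE /phi ler_pdivlMr; last by lra.
  by rewrite mulrC ler_pdivrMr; lra.
- move=> z s zE s0 sy _ /(zP z s s0 sy) ->; exists (- s / (1 + s)) => //=.
  by rewrite in_itv /=; exact: tP.
Qed.

Lemma right_side c y' : D c -> 0 < y' < 1 -> y = phi c y' ->
  side_cover [set s | 1 < s].
Proof.
move=> Dc /andP[y'0 y'1] yc; have [y0 y1] := andP y01.
have [yr|yr] := ltP y (1 - 5 * rho).
  by apply: side_cover0 => z s _ /= s0; rewrite ler_norml => /andP[_ h] _ _; lra.
have [u0|un] := eqVneq u [::].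
  apply: side_cover0 => z s /(limset_bounds _ _ HE)/andP[_ z1] /= s0 _ _.
  by rewrite u0 /= divr1 => zs; lra.
have rs := small un.
have Ec := DE _ Dc; have c1 := @natr_ge1 R _ (HE _ Ec).
(* Here [y >= 11 / 16], so [c + y' = y^-1 <= 16 / 11 < 2]. *)
have c1E : c = 1%N.
  have : c%:R < (2%:R : R).
    have : 11 / 16 * (c%:R + y') <= y * (c%:R + y') by rewrite ler_wpM2r; lra.
    have -> : y * (c%:R + y') = 1 by rewrite yc /phi mulVf // lt0r_neq0; lra.
    lra.
  by rewrite ltr_nat; case: (c) (HE _ Ec) => [|[|]].
have [v [a uva]] : exists v a, u = rcons v a.
  by case/lastP: (u) un => // v a _; exists v, a.
(* Moving one unit from the coordinate to the last letter: [a + s = (a + 1) + (s - 1)]. *)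
have next s : mob u (s, 1) = mob (rcons v a.+1) (s - 1, 1) :> R * R.
  by rewrite uva !mob_rcons; congr (mob v (_, _)); rewrite -natr1; ring.
have va : posw (rcons v a.+1).
  by move: pu; rewrite uva /posw !all_rcons => /andP[].
have sP s : 1 < s -> `|s - y| <= 5 * rho -> 0 <= s - 1 <= 1.
  by move=> s1; rewrite ler_norml; lra.
have zP z s : 1 < s -> `|s - y| <= 5 * rho ->
    z = (mob u (s, 1)).1 / (mob u (s, 1)).2 -> z = phiw (rcons v a.+1) (s - 1).
  move=> s1 sy ->; have /andP[t0 t1] := sP s s1 sy.
  by rewrite phiw_mob // -next.
have [L|L] := pselect (forall b, b \in rcons v a.+1 -> E b); last first.
  apply: side_cover0 => z s zE s1 sy _ /(zP z s s1 sy) zz; apply: L.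
  rewrite zz in zE.
  by have [] := limset_cyl E _ _ HE va (sP s s1 sy) zE.
exists (cyl (rcons v a.+1)); split.
- exact: measurable_cyl.
- apply: mu_conj_le => //.
  (* Equal continuants let the whole cylinder of [v(a+1)] be charged to that of [u1], which is one
     term of [M] because [c = 1] lies in [D]. *)
  have -> : cden (rcons v a.+1) = cden (rcons u 1%N) :> R.
    by rewrite /cden [in RHS]mob_rcons mulr1 addr0 next subrr.
  have u1L : forall b, b \in rcons u 1%N -> E b.
    by apply: letters_rcons => //; rewrite -c1E.
  have [_ lo _] := mu_phiw E delta mu HE Hmu _ I01 u1L (measurable_itv _)
    (@subset_refl _ _).
  apply: le_trans lo _; apply: lee_wpmul2l; first by rewrite lee_fin expR_ge0.
  apply: mu_cover => [b /DE Eb||z [zc _]].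
  + by apply: measurable_cyl; exact: letters_rcons.
  + exact: measurable_cyl.
  + by exists 1%N => //; rewrite -c1E.
- move=> z s zE s1 sy _ /(zP z s s1 sy) ->; exists (s - 1) => //=.
  by rewrite in_itv /=; exact: sP.
Qed.

End Sides.
End Covering.

(** * Sizes of letters and growth of continuants at the scale of the ball *)

Section Scale.
Context {R : realType}.

(** The lower bound on [c + 1] gives [y ^+ 2 <= 64 * rho], where [y = phi c y']. A letter [a] with a
    point [s] within [5 * rho] of [y] then has [s ^+ 2] of order [rho], and [2 * s ^+ 2] bounds the
    distance from [s] to any other point of its interval. *)
Lemma letter_size (a c : nat) (s' t' y' rho : R) :
  (0 < a)%N -> (0 < c)%N -> 0 <= s' <= 1 -> 0 <= t' <= 1 -> 0 <= y' <= 1 ->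
  16^-1 < (c%:R + 1) ^+ 2 * rho -> `|phi a s' - phi c y'| <= 5 * rho ->
  `|phi a t' - phi c y'| <= 281 * rho.
Proof.
move=> /(@natr_ge1 R) a1 /(@natr_ge1 R) c1 /andP[s0 s1] /andP[t0 t1] /andP[y0 y1].
move=> big near.
set A : R := a%:R in a1 *; set c' : R := c%:R in c1 big *.
set s := phi a s' in near *; set y := phi c y' in near *; set t := phi a t'.
have sA : s = (A + s')^-1 by []. have tA : t = (A + t')^-1 by [].
have yc : y = (c' + y')^-1 by [].
have s01 : 0 < s <= 1 by rewrite sA invr_gt0 invf_le1; lra.
have y01 : 0 < y <= 1 by rewrite yc invr_gt0 invf_le1; lra.
have y2 : y ^+ 2 <= 64 * rho.
  have : y * (c' + 1) <= 2 by rewrite yc mulrC ler_pdivrMr; lra.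
  have : 0 <= y * (c' + 1) by rewrite mulr_ge0; lra.
  move=> h0 h2.
  have h4 : (y * (c' + 1)) ^+ 2 <= 4 by nra.
  have : y ^+ 2 <= y ^+ 2 * (16 * ((c' + 1) ^+ 2 * rho)).
    by rewrite ler_peMr ?sqr_ge0 //; lra.
  have rho0 : 0 <= rho by move: (normr_ge0 (s - y)); lra.
  have -> : y ^+ 2 * (16 * ((c' + 1) ^+ 2 * rho)) =
    16 * (y * (c' + 1)) ^+ 2 * rho by ring.
  move=> h; apply: le_trans h _; rewrite ler_wpM2r //; lra.
have sy2 : (s - y) ^+ 2 <= 5 * rho.
  apply: le_trans near; rewrite -real_normK ?num_real // expr2 ler_piMr //.
  by rewrite ler_norml; lra.
(* [138 = 2 * (64 + 5)], from the square of [s = y + (s - y)]; the final constant is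
   [281 = 2 * 138 + 5]. *)
have s2 : s ^+ 2 <= 138 * rho by nra.
have ts : `|t - s| <= 2 * s ^+ 2.
  have -> : t - s = (s' - t') * (s * t).
    by rewrite sA tA; field; apply/andP; split; rewrite lt0r_neq0 //; lra.
  have t2s : t <= 2 * s.
    rewrite sA tA ler_pdivlMr; last by lra.
    by rewrite mulrC ler_pdivrMr; lra.
  have t00 : 0 < t by rewrite tA invr_gt0; lra.
  rewrite normrM (ger0_norm (_ : 0 <= s * t)); last by rewrite mulr_ge0; lra.
  have -> : 2 * s ^+ 2 = 1 * (s * (2 * s)) by ring.
  apply: ler_pM => //; first by rewrite mulr_ge0; lra.
  - by rewrite ler_norml; lra.
  - by rewrite ler_wpM2l //; lra.
apply: le_trans (ler_distD s _ _) _; lra.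
Qed.

Lemma cden_unbounded (w : nat -> nat) (r : R) : (forall k, (0 < w k)%N) ->
  0 < r -> exists n, 16^-1 < cden (pref w n.+1) ^+ 2 * r.
Proof.
move=> w0 r0.
have h : `|4 / 9 : R| < 1 by rewrite ger0_norm; lra.
have [N _ HN] := @cvgr_lt R _ _ _ _ _ (cvg_expr h) r r0.
have := HN N.+1 (leqnSn N) => /= {}HN.
exists N; have pw := posw_pref w N.+1 w0.
have Q0 := @cden_gt0 R _ pw.
have := @cden_sqr_geo R _ pw; rewrite size_mkseq => g.
have Q2 : 0 < cden (pref w N.+1) ^+ 2 :> R by rewrite exprn_gt0.
rewrite -ltr_pdivrMl // ; lra.
Qed.

End Scale.

Theorem theorem3p2 (R : realType) (E : set nat) (delta : R)
  (mu : probability R R)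
  (HE : forall a, E a -> (0 < a)%N)
  (Hreg : regular E delta)
  (Hmu : conformal E delta mu) :
  exists C : R, 1 <= C /\
  exists K : R, 0 < K /\
  forall w : nat -> nat, (forall k, E (w k)) ->
  forall r : R, 0 < r ->
  exists n : nat,
    cyl (pref w n.+1) `<=` ball (cfpi w : R) (C * r) /\
    (Msum E mu w n r <= mu (ball (cfpi w : R) r))%E /\
    (mu (ball (cfpi w : R) r) <= K%:E * Msum E mu w n (C * r))%E.
Proof.
pose K := dist_const delta.
(* [300] strictly exceeds the [281] of [letter_size], as balls are open, and the [16] from the
   choice of [n]. In the second constant, [1] pays for the inside of the cylinder and [K * K] for
   each side. *)
exists 300; split; first by lra.
exists (1 + K * K + K * K).
have K0 : 0 <= K * K by rewrite mulr_ge0 ?expR_ge0.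
split; first by lra.
move=> w Ew r r0.
have w0 k : (0 < w k)%N by exact: HE.
pose P n := (16^-1 < (cden (pref w n.+1) : R) ^+ 2 * r).
have exP : exists n, P n := cden_unbounded w r w0 r0.
case: (ex_minnP exP) => n Pn minn; exists n.
set u := pref w n; set x : R := cfpi w.
have uE a : a \in u -> E a by move=> /mapP[k _ ->]; exact: Ew.
have pu : posw u by exact: posw_pref.
have ws k m : (0 < wshift k w m)%N by exact: w0.
pose y : R := cfpi (wshift n w); pose y' : R := cfpi (wshift n.+1 w).
have y01 : 0 < y < 1 by exact: cfpi_bounds.
have y'01 : 0 < y' < 1 by exact: cfpi_bounds.
have [y0 y1] := andP y01; have [y'0 y'1] := andP y'01.
have xE : x = phiw u y by exact: cfpi_phiw.
have yE : y = phi (w n) y'.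
  rewrite /y cfpi_phi // /wshift addn0; congr (phi _ (cfpi _)).
  by apply/funext => k; rewrite addnA addn1.
have Q0 := @cden_gt0 R u pu.
set Q : R := cden u in Q0.
pose rho := Q ^+ 2 * r.
have rho0 : 0 < rho by rewrite mulr_gt0 // exprn_gt0.
(* Minimality of [n] tested at [n.-1]; for [n = 0] it says nothing, hence the guard. *)
have small : u != [::] -> rho <= 16^-1.
  rewrite -size_eq0 size_mkseq -lt0n => n0; rewrite leNgt; apply/negP => Pm.
  by have := minn n.-1; rewrite /P prednK // => /(_ Pm); rewrite leqNgt ltn_predL n0.
have big : 16^-1 < ((w n)%:R + 1) ^+ 2 * rho.
  apply: lt_le_trans Pn _; rewrite /rho mulrA ler_pM2r // -exprMn.
  rewrite ler_sqr ?nnegrE; first by rewrite pref_rcons cden_rcons_le.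
    by rewrite ltW // cden_gt0 //; exact: posw_pref.
  by rewrite mulr_ge0 // ltW.
have ballP z e : ball x e z <-> `|x - z| < e by rewrite -ball_normE.
have cylball : cyl (pref w n.+1) `<=` ball x (300 * r).
  move=> _ [t + <-]; rewrite /= in_itv /= => /andP[t0 t1]; apply/ballP.
  have pw := posw_pref w n.+1 w0.
  have -> : x = phiw (pref w n.+1) y' by exact: cfpi_phiw.
  apply: le_lt_trans (phiw_dist _ _ _ pw (ltW y'0) t0) _.
  rewrite ltr_pdivrMr ?exprn_gt0 ?cden_gt0 //.
  have d1 : `|y' - t| <= 1 by rewrite ler_norml; lra.
  by move: Pn; rewrite /P; lra.
split=> //; split.
  apply: (mu_disjoint E delta mu Hmu) => [a [Ea _]||a [] //|].
  - by apply: measurable_cyl Hmu _ _ => //; exact: letters_rcons.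
  - exact: measurable_ball.
  move=> a b z [Ea _] [Eb _] [w' Ew' <-] [s s01 sE] [t t01 tE].
  have w'0 k : (0 < w' k)%N by exact: HE.
  have pc c : E c -> posw (rcons u c).
    by move=> Ec; apply: posw_letters HE _ _; exact: letters_rcons.
  move: s01 t01; rewrite /= !in_itv /= => s01 t01.
  (* Both words are the prefix of the same length of the expansion of the common point. *)
  have [e1 _] := cfpi_cyl w' _ s w'0 (pc _ Ea) s01 (esym sE).
  have [e2 _] := cfpi_cyl w' _ t w'0 (pc _ Eb) t01 (esym tE).
  by apply: (@rcons_injr _ u); rewrite e1 e2 !size_rcons.
pose D := [set a | E a /\ cyl (rcons u a) `<=` ball x (300 * r)].
set M := Msum _ _ _ _ _.
have DE : D `<=` E by move=> a [].
have HD a : E a ->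
    (forall t, (phi a @` `[0, 1]%classic) t -> `|t - y| <= 281 * rho) -> D a.
  move=> Ea H; split=> // _ [t t01 <-]; apply/ballP.
  rewrite phiw_rcons distrC xE.
  have at0 : 0 <= phi a t.
    by move: t01; rewrite /= in_itv /= /phi invr_ge0 => /andP[t0 _]; rewrite addr_ge0.
  apply: le_lt_trans (phiw_dist _ _ _ pu at0 (ltW y0)) _.
  rewrite ltr_pdivrMr ?exprn_gt0 //.
  apply: le_lt_trans (H _ _) _; first by exists t.
  by rewrite -/Q mulrAC -mulrA -/rho; lra.
have Dwn : D (w n) by split; [exact: Ew|rewrite -pref_rcons].
have [X [mX Xle HX]] := left_side E delta mu HE Hmu u y rho D uE y01 small DE HD.
have [Y [mY Yle HY]] := right_side E delta mu HE Hmu u y rho D uE y01 small DE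
  (w n) y' Dwn y'01 yE.
pose U := \bigcup_(a in D) cyl (rcons u a) : set R.
have mcyl a : D a -> measurable (cyl (rcons u a) : set R).
  by move=> /DE Ea; apply: measurable_cyl Hmu _ _ => //; exact: letters_rcons.
have mU : measurable U by exact: bigcup_measurable.
have UM : (mu U <= M)%E.
  by apply: (mu_cover E delta mu Hmu) => // z [].
have cover : ball x r `&` limset E `<=` U `|` X `|` Y.
  move=> z [/ballP zr zE].
  have [z0 z1] := andP (limset_bounds E z HE zE).
  have [s [sy D0 zs]] : exists s, [/\ `|s - y| <= 5 * rho,
      0 < (mob u (s, 1)).2 & z = (mob u (s, 1)).1 / (mob u (s, 1)).2].
    (* For empty [u] the coordinate is [z] itself; otherwise [rho] is small and [mob_near]
       applies. *)
    have [u0|un] := eqVneq u [::].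
      exists z; rewrite u0 /= divr1; split=> //.
      rewrite distrC; have -> : y = x by rewrite xE u0.
      by move: zr; rewrite /rho /Q u0 /cden /= expr1n mul1r; lra.
    have y01' : 0 <= y <= 1 by rewrite !ltW.
    by apply: (mob_near u y z r pu y01' r0 (small un)); rewrite -xE distrC.
  have [s0|s0] := ltP s 0; first by left; right; exact: HX sy D0 zs.
  have [s1|s1] := ltP 1 s; first by right; exact: HY sy D0 zs.
  left; left.
  have s01 : 0 <= s <= 1 by rewrite s0.
  have zs' : z = phiw u s by rewrite phiw_mob.
  have zE' : limset E (phiw u s) by rewrite -zs'.
  (* Removing [u] and then one more letter exhibits the cylinder [ua] containing [z]; [letter_size]
     puts all of it in the enlarged ball. *)
  have [_ /(limset_phi _ _ HE)[a Ea [s' s'E sE]]] := limset_cyl E u s HE pu s01 zE'.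
  have [s'0 s'1] := andP (limset_bounds E s' HE s'E).
  exists a; last by exists s'; rewrite ?phiw_rcons -?sE //= in_itv /= !ltW.
  apply: HD => // _ [t t01 <-]; rewrite yE.
  apply: (letter_size a (w n) s') => //;
    rewrite ?(ltW s'0) ?(ltW s'1) ?(ltW y'0) ?(ltW y'1) //.
  - exact: HE.
  - by rewrite -sE -yE.
have mB : measurable (ball x r) by exact: measurable_ball.
have mUX : measurable (U `|` X) by exact: measurableU.
apply: le_trans (mu_le E delta mu Hmu _ _ mB (measurableU _ _ mUX mY) cover) _.
apply: le_trans (measureU2 _ mUX mY) _.
rewrite !EFinD !ge0_muleDl ?lee_fin ?addr_ge0 // mul1e.
apply: leeD => //; apply: le_trans (measureU2 _ mU mX) _.
exact: leeD.
Qed.
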